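(* (a) If $G_1$ and $G_2$ are $A$-cospectral regular graphs, and $H$ is any graph, then $G_1\dot{\vee} H$ and $G_2\dot{\vee} H$ are $A$-cospectral. (b) If $G$ is a regular graph, and $H_1$ and $H_2$ are $A$-cospectral graphs with $\Gamma_{A(H_1)}(x)=\Gamma_{A(H_2)}(x)$, then $G\dot{\vee} H_1$ and $G\dot{\vee} H_2$ are $A$-cospectral.
   Context: All graphs are finite, simple and undirected, with at least one vertex. $A(G)$ is the adjacency matrix of $G$; two graphs are $A$-cospectral if their adjacency matrices have the same spectrum (eigenvalues counted with multiplicity). For an $n\times n$ matrix $M$, the $M$-coronal is the rational function $\Gamma_M(x)=\mathbf{1}_n^T(xI_n-M)^{-1}\mathbf{1}_n$, where $\mathbf{1}_n$ is the all-ones column vector. The subdivision graph $\mathcal{S}(G)$ is obtained from $G$ by inserting a new vertex into every edge of $G$. For vertex-disjoint graphs $G,H$, the subdivision-vertex join $G\dot{\vee}H$ is the graph obtained from $\mathcal{S}(G)$ and $H$ by joining every vertex of $V(G)$ (the original vertices) with every vertex of $V(H)$. *)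

(* Defs.v *)
From mathcomp Require Import all_boot all_order all_algebra all_field.

Set Implicit Arguments.
Unset Strict Implicit.
Unset Printing Implicit Defensive.

Import GRing.Theory.
Local Open Scope ring_scope.

Record graph := Graph {
  vertex :> finType;
  adj : rel vertex;
  adj_sym : symmetric adj;
  adj_irr : irreflexive adj;
  graph_nonempty : (0 < #|vertex|)%N }.

Definition edges (G : graph) : {set {set G}} :=
  [set [set p.1; p.2] | p : G * G & adj p.1 p.2].

Definition edge (G : graph) : finType := {e : {set G} | e \in edges G}.

Definition regular (G : graph) : Prop :=
  exists r : nat, forall x : G, #|[set y | adj x y]| = r.

Section Subdivision.
Variable G : graph.

Definition subdiv_adj : rel (G + edge G)%type := fun u v =>
  match u, v with
  | inl x, inr e | inr e, inl x => x \in val e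
  | _, _ => false
  end.

Lemma subdiv_adj_sym : symmetric subdiv_adj.
Proof. by case=> x [] y. Qed.

Lemma subdiv_adj_irr : irreflexive subdiv_adj.
Proof. by case. Qed.

Lemma subdiv_nonempty : (0 < #|{: G + edge G}|)%N.
Proof. by rewrite card_sum addn_gt0 graph_nonempty. Qed.

Definition subdivision : graph :=
  Graph subdiv_adj_sym subdiv_adj_irr subdiv_nonempty.

End Subdivision.

Section SubdivisionVertexJoin.
Variables G H : graph.

Definition svjoin_adj : rel (subdivision G + H)%type := fun u v =>
  match u, v with
  | inl s, inl t => adj s t
  | inr y, inr z => adj y z
  | inl (inl _), inr _ | inr _, inl (inl _) => true
  | inl (inr _), inr _ | inr _, inl (inr _) => false
  end.

Lemma svjoin_adj_sym : symmetric svjoin_adj.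
Proof. by move=> [[x|e]|y] [[x'|e']|y'] //=; apply: adj_sym. Qed.

Lemma svjoin_adj_irr : irreflexive svjoin_adj.
Proof. by move=> [[x|e]|y] //=; apply: adj_irr. Qed.

Lemma svjoin_nonempty : (0 < #|{: subdivision G + H}|)%N.
Proof. by rewrite card_sum addn_gt0 graph_nonempty. Qed.

Definition svjoin : graph :=
  Graph svjoin_adj_sym svjoin_adj_irr svjoin_nonempty.

End SubdivisionVertexJoin.

(* The eigenvalues of an integer matrix are algebraic, so no part of the
   spectrum is lost by working over [algC]. *)
Definition adjmx (G : graph) : 'M[algC]_#|G| :=
  \matrix_(i, j) (adj (enum_val i) (enum_val j))%:R.

(* [0] when [a] is not an eigenvalue of [M]. *)
Definition eigen_mult n (M : 'M[algC]_n) (a : algC) : nat :=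
  mup a (char_poly M).

Definition A_cospectral (G1 G2 : graph) : Prop :=
  forall a : algC, eigen_mult (adjmx G1) a = eigen_mult (adjmx G2) a.

(* Computed over the field of rational functions [algC(x)], where [x I - M] is
   always invertible, so [invmx] is the genuine inverse. *)
Definition coronal n (M : 'M[algC]_n) : {fraction {poly algC}} :=
  let ones : 'cV[{fraction {poly algC}}]_n := const_mx 1 in
  let x := tofrac 'X in
  (ones^T *m invmx (x%:M - map_mx (fun c => tofrac c%:P) M) *m ones) 0 0.

(* Main.v *)
(** Let [R] be the vertex-edge incidence matrix of an [r]-regular graph [G] with
    [n] vertices and [m] edges, so that [R R^T = A + r I] for [A = A(G)].
    Eliminating first the vertices of [H] and then the edge vertices by Schur
    complements over the field [algC(x)] leaves
    [x I - (A + r I) / x - Gamma_H(x) J], a rank one perturbation along the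
    all-ones eigenvector of [A]. Hence the characteristic polynomial of the join is
    [x^(m - n) phi_G(x^2 - r) phi_H(x) (1 - n Gamma_H(x) / (x - 2 r / x))].
    It depends on [H] only through [phi_H] and [Gamma_H], and on [G] only through
    [n], [m], [r] and [phi_G]; here [n] is the degree of [phi_G], [r] is its
    largest root, and [2 m = n r]. *)

Require Import Defs.
From mathcomp Require Import all_boot all_order all_fingroup all_algebra all_field.

Set Implicit Arguments.
Unset Strict Implicit.
Unset Printing Implicit Defensive.

Import Order.TTheory GRing.Theory Num.Theory.
Local Open Scope ring_scope.

(** * Characteristic polynomials and determinant identities *)

(** Both polynomials are monic and split over [algC], so equal multiplicities make their root lists
    permutations of each other. *)
Lemma char_poly_cospectral n1 n2 (A1 : 'M[algC]_n1) (A2 : 'M[algC]_n2) :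
  (forall a, eigen_mult A1 a = eigen_mult A2 a) ->
  char_poly A1 = char_poly A2.
Proof.
move=> eqm.
have [s1 e1] := closed_field_poly_normal (char_poly A1).
have [s2 e2] := closed_field_poly_normal (char_poly A2).
move: e1 e2; rewrite !(monicP (char_poly_monic _)) !scale1r => e1 e2.
rewrite e1 e2; apply: perm_big; apply/allP => a _ /=; apply/eqP.
by have := eqm a; rewrite /eigen_mult e1 e2 !mu_prod_XsubC.
Qed.

(** Column operations by a unipotent block matrix clear the lower left block. *)
Lemma det_schur (K : fieldType) n m (A : 'M[K]_n) B C (D : 'M[K]_m) :
  D \in unitmx ->
  \det (block_mx A B C D) = \det D * \det (A - B *m invmx D *m C).
Proof.
move=> uD.
have: block_mx A B C D *m block_mx 1%:M 0 (- (invmx D *m C)) 1%:M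
      = block_mx (A - B *m invmx D *m C) B 0 D.
  rewrite mulmx_block !mulmx1 !mulmx0 !add0r !mulmxN mulmxA mulKVmx //.
  by rewrite subrr.
move/(congr1 determinant); rewrite det_mulmx det_lblock det_ublock !det1.
by rewrite !mulr1 => ->; rewrite mulrC.
Qed.

(** Sylvester's identity: both sides are the determinant of the block matrix with rows [1, U] and
    [V, 1], eliminated in two ways. *)
Lemma det_sub_mulmxC (K : fieldType) n m (U : 'M[K]_(n, m)) V :
  \det (1%:M - U *m V) = \det (1%:M - V *m U).
Proof.
have: block_mx 1%:M U V 1%:M
      = block_mx 1%:M 0 V 1%:M *m block_mx 1%:M U 0 (1%:M - V *m U).
  rewrite mulmx_block !mulmx1 !mul1mx !mulmx0 !mul0mx !addr0.
  by rewrite addrC subrK.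
move/(congr1 determinant); rewrite det_mulmx det_lblock det_ublock !det1.
by rewrite !mul1r det_schur ?unitmx1 // invmx1 mulmx1 det1 mul1r.
Qed.

(** Since [u = C *m (c^-1 *: u)], the factor [C] splits off on the left, and Sylvester's identity
    turns the rest into a 1 by 1 determinant. *)
Lemma det_sub_eigen_rank1 (K : fieldType) n (C : 'M[K]_n) (u : 'cV_n) c g :
  C *m u = c *: u -> c != 0 ->
  \det (C - g *: (u *m u^T)) = \det C * (1 - g / c * (u^T *m u) 0 0).
Proof.
move=> Cu c0.
have -> : C - g *: (u *m u^T) = C *m (1%:M - ((g / c) *: u) *m u^T).
  rewrite mulmxBr mulmx1 mulmxA -scalemxAr Cu scalerA divfK //.
  by rewrite scalemxAl.
rewrite det_mulmx det_sub_mulmxC -scalemxAr.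
by rewrite [\det (1%:M - _ *: _)]det_mx11 !mxE.
Qed.

(** The two indexings differ by one permutation acting on rows and columns alike, so its sign occurs
    twice and cancels. *)
Lemma det_reindex (R : comNzRingType) (T : finType) n k
    (f : 'I_n -> T) (g : 'I_k -> T) (F : T -> T -> R) :
  bijective f -> bijective g ->
  \det (\matrix_(i, j) F (f i) (f j)) = \det (\matrix_(i, j) F (g i) (g j)).
Proof.
move=> bf bg.
have ekn : k = n.
  by have := bij_eq_card bf; rewrite -(bij_eq_card bg) !card_ord.
case: n / ekn f bf => f [f' fK f'K].
have inj_s : injective (f' \o g).
  exact: inj_comp (can_inj f'K) (bij_inj bg).
pose s := perm inj_s.
have -> : \matrix_(i, j) F (g i) (g j)
          = row_perm s (col_perm s (\matrix_(i, j) F (f i) (f j))).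
  by apply/matrixP => i j; rewrite !mxE !permE /= !f'K.
rewrite row_permE col_permE !det_mulmx !det_perm odd_permV.
by rewrite mulrC -mulrA -signr_addb addbb mulr1.
Qed.

Lemma horner_char_poly (R : comNzRingType) n (A : 'M[R]_n) y :
  (char_poly A).[y] = \det (y%:M - A).
Proof.
rewrite -[LHS]/(horner_eval y _) /char_poly -det_map_mx; congr (\det _).
apply/matrixP => i j; rewrite !mxE /= /horner_eval.
by rewrite hornerD hornerN hornerC hornerMn hornerX.
Qed.

(** * Vertex-edge incidences *)

Section Incidence.
Variable G : graph.

Lemma edgesP (e : {set G}) :
  reflect (exists x y : G, adj x y /\ e = [set x; y]) (e \in edges G).
Proof.
apply: (iffP imsetP) => [[[x y] xy ->]|[x [y [xy ->]]]]; last first.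
  by exists (x, y); rewrite ?inE.
by exists x, y; rewrite inE in xy.
Qed.

Lemma card_edge_set (P : pred {set G}) :
  #|[set e : edge G | P (val e)]| = #|[set e in edges G | P e]|.
Proof.
rewrite -(card_imset _ val_inj); apply: eq_card => e; rewrite !inE.
apply/imsetP/andP => [[[e' Ge'] /=]|[Ge Pe]].
  by rewrite inE /= => Pe' ->.
by exists (exist _ e Ge); rewrite ?inE.
Qed.

(** Sending a neighbour [y] to [[set x; y]] is a bijection onto the edges at [x]; it is injective
    because there are no loops. *)
Lemma incident_edges_card (x : G) :
  #|[set e : edge G | x \in val e]| = #|[set y | adj x y]|.
Proof.
rewrite (card_edge_set (fun e => x \in e)).
have <- : [set [set x; y] | y in [set y | adj x y]]
          = [set e in edges G | x \in e].
  apply/setP => e; rewrite inE; apply/imsetP/andP => [[y]|[/edgesP]].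
    rewrite inE => xy ->; split; last by rewrite !inE eqxx.
    by apply/edgesP; exists x, y.
  move=> [a [b [ab ->]]]; rewrite !inE => /orP[] /eqP ->.
    by exists b; rewrite ?inE.
  by exists a; rewrite 1?setUC // inE adj_sym.
rewrite card_in_imset // => y z; rewrite !inE => xy xz eyz.
have : y \in [set x; z] by rewrite -eyz !inE eqxx orbT.
by rewrite !inE => /orP[] /eqP // yx; rewrite yx adj_irr in xy.
Qed.

Lemma common_edges_card (x y : G) : x != y ->
  #|[set e : edge G | (x \in val e) && (y \in val e)]| = adj x y.
Proof.
move=> nxy; rewrite (card_edge_set (fun e => (x \in e) && (y \in e))).
have sub e : e \in edges G -> x \in e -> y \in e -> adj x y /\ e = [set x; y].
  move/edgesP => [a [b [ab ->]]].
  rewrite !inE => /orP[] /eqP ex /orP[] /eqP ey; subst => //.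
  - by rewrite eqxx in nxy.
  - by rewrite adj_sym setUC.
  - by rewrite eqxx in nxy.
case xy: (adj x y).
  rewrite [RHS]/= -(cards1 [set x; y]); apply: eq_card => e; rewrite !inE.
  apply/andP/eqP => [[Ge /andP[xe ye]]|->]; first by have [] := sub e Ge xe ye.
  by rewrite !inE !eqxx orbT; split=> //; apply/edgesP; exists x, y.
apply: eq_card0 => e; rewrite !inE; apply/and3P => -[Ge xe ye].
by have [] := sub e Ge xe ye; rewrite xy.
Qed.

(** Double counting of incident pairs: each vertex lies on [r] edges and each edge has two ends. *)
Lemma handshake r : (forall x : G, #|[set y | adj x y]| = r) ->
  (#|G| * r)%N = #|edge G|.*2.
Proof.
move=> reg; rewrite -muln2 -sum_nat_const -[RHS]sum_nat_const.
have -> : (\sum_(x in G) r = \sum_(x : G) \sum_(e : edge G) (x \in val e))%N.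
  apply: eq_bigr => x _; rewrite -(reg x) -incident_edges_card.
  by rewrite -sum1dep_card big_mkcond; apply: eq_bigr => e _; case: (_ \in _).
rewrite exchange_big; apply: eq_bigr => -[e Ge] _ /=.
have [x [y [xy ->]]] := edgesP _ Ge.
transitivity #|[set x; y]|.
  by rewrite -sum1_card [RHS]big_mkcond; apply: eq_bigr => z _; case: (_ \in _).
by rewrite cards2; case: eqP xy => // ->; rewrite adj_irr.
Qed.

Definition incmx (R : nzRingType) : 'M[R]_(#|G|, #|edge G|) :=
  \matrix_(i < #|G|, j < #|edge G|)
    ((enum_val i : G) \in val (enum_val j : edge G))%:R.

(** Entry [(i, j)] counts the edges through both vertices: the degree on the diagonal, adjacency
    elsewhere. *)
Lemma incmx_mul_tr (R : nzRingType) r :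
  (forall x : G, #|[set y | adj x y]| = r) ->
  incmx R *m (incmx R)^T
  = \matrix_(i, j) (adj (enum_val i) (enum_val j))%:R + r%:R%:M.
Proof.
move=> reg; apply/matrixP => i j; rewrite !mxE.
transitivity (#|[set e : edge G | (enum_val i \in val e)
                                  && (enum_val j \in val e)]|%:R : R).
  rewrite -sum1dep_card natr_sum [RHS]big_mkcond /=.
  rewrite [RHS](reindex (fun k : 'I_#|edge G| => enum_val k)) /=; last first.
    exact: onW_bij (@enum_val_bij _).
  apply: eq_bigr => k _; rewrite !mxE -natrM.
  by case: (_ \in _); case: (_ \in _).
have [<-|nij] := eqVneq i j.
  rewrite adj_irr add0r mulr1n -(reg (enum_val i)) -incident_edges_card.
  by congr (_%:R); apply: eq_card => e; rewrite !inE andbb.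
by rewrite common_edges_card ?addr0 // (inj_eq enum_val_inj).
Qed.

End Incidence.

(** * The degree of a regular graph as its largest eigenvalue *)

Lemma adjmx_regular (G : graph) r :
  (forall x : G, #|[set y | adj x y]| = r) ->
  adjmx G *m const_mx 1 = r%:R *: const_mx 1 :> 'cV_#|G|.
Proof.
move=> reg; apply/matrixP => i j; rewrite !mxE mulr1 -(reg (enum_val i)).
rewrite -sum1dep_card natr_sum [RHS]big_mkcond /=.
rewrite [RHS](reindex (fun k : 'I_#|G| => enum_val k)) /=; last first.
  exact: onW_bij (@enum_val_bij _).
by apply: eq_bigr => k _; rewrite !mxE mulr1; case: adj.
Qed.

Lemma adjmx_tr (G : graph) : (adjmx G)^T = adjmx G.
Proof. by apply/matrixP => i j; rewrite !mxE adj_sym. Qed.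

Lemma degree_eigenvalue (G : graph) r :
  (forall x : G, #|[set y | adj x y]| = r) -> eigenvalue (adjmx G) r%:R.
Proof.
move=> reg; apply/eigenvalueP; exists (const_mx 1).
  rewrite -[LHS]trmxK trmx_mul adjmx_tr trmx_const (adjmx_regular reg).
  by rewrite linearZ /= trmx_const.
(* The all-ones vector is nonzero because a graph has a vertex. *)
apply/eqP => /matrixP /(_ 0 (Ordinal (graph_nonempty G))) /eqP.
by rewrite !mxE oner_eq0.
Qed.

(** At a coordinate of largest modulus, the eigenvector equation has nonnegative weights of sum [r]
    applied to entries of at most that modulus. *)
Lemma eigenvalue_le_degree (G : graph) r a :
  (forall x : G, #|[set y | adj x y]| = r) ->
  eigenvalue (adjmx G) a -> `|a| <= r%:R.
Proof.
move=> reg /eigenvalueP[v va v0].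
have [j0 vj0] : exists j, v 0 j != 0.
  apply/existsP; apply: contraNT v0 => /existsPn v0.
  by apply/eqP/rowP => j; rewrite mxE; apply/eqP/negPn/v0.
(* The order on [algC] is partial; a maximum exists among the moduli because they are real. *)
have vreal j : true -> `|v 0 j| \is Num.real by rewrite normr_real.
have [j _ vmax] := @real_arg_maxP _ _ j0 predT (fun j => `|v 0 j|) isT vreal.
have vj : 0 < `|v 0 j|.
  by rewrite (lt_le_trans _ (vmax j0 isT)) // normr_gt0.
rewrite -(ler_pM2r vj) -normrM.
have -> : a * v 0 j = (v *m adjmx G) 0 j by rewrite va mxE.
rewrite mxE (le_trans (ler_norm_sum _ _ _)) //.
have -> : r%:R * `|v 0 j| = \sum_i `|v 0 j| * adjmx G i j.
  have /matrixP/(_ j 0) := adjmx_regular reg; rewrite !mxE mulr1 => <-.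
  rewrite mulr_suml; apply: eq_bigr => i _.
  by rewrite [RHS]mulrC !mxE mulr1 adj_sym.
apply: ler_sum => i _; rewrite normrM.
have /ger0_norm -> : 0 <= adjmx G i j by rewrite mxE ler0n.
by apply: ler_wpM2r; [rewrite mxE ler0n | exact: vmax].
Qed.

(** [r1] is an eigenvalue of [G1], hence of [G2], where [r2] bounds it. Used in both directions,
    this gives equal degrees. *)
Lemma cospectral_degree_le (G1 G2 : graph) r1 r2 :
  (forall x : G1, #|[set y | adj x y]| = r1) ->
  (forall x : G2, #|[set y | adj x y]| = r2) ->
  char_poly (adjmx G1) = char_poly (adjmx G2) -> (r1 <= r2)%N.
Proof.
move=> reg1 reg2 eqp; rewrite -(ler_nat algC) -[r1%:R]ger0_norm ?ler0n //.
apply: (eigenvalue_le_degree reg2).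
by rewrite eigenvalue_root_char -eqp -eigenvalue_root_char degree_eigenvalue.
Qed.

(** * The characteristic polynomial of the join *)

Lemma det_svjoin_block (K : fieldType) n m h (A : 'M[K]_n) (R : 'M_(n, m))
    (B : 'M_h) (x r : K) :
  let u := const_mx 1 : 'cV[K]_n in
  let w := const_mx 1 : 'cV[K]_h in
  R *m R^T = A + r%:M -> A *m u = r *: u ->
  x != 0 -> x ^+ 2 != r *+ 2 -> x%:M - B \in unitmx ->
  \det (block_mx (block_mx x%:M (- R) (- R^T) x%:M)
                 (col_mx (const_mx (-1)) 0) (row_mx (const_mx (-1)) 0)
                 (x%:M - B))
  = x ^+ m / x ^+ n * \det ((x ^+ 2 - r)%:M - A) * \det (x%:M - B)
    * (1 - (w^T *m invmx (x%:M - B) *m w) 0 0 * n%:R / (x - r *+ 2 / x)).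
Proof.
move=> u w RR Au x0 x2r uB; rewrite det_schur //.
set g := (w^T *m _ *m w) 0 0.
have eJ p q : const_mx (-1)
    = - ((const_mx 1 : 'cV_p) *m (const_mx 1 : 'cV_q)^T) :> 'M[K]_(p, q).
  by apply/matrixP => i j; rewrite !mxE big_ord1 !mxE mulr1.
(* Eliminating [H] changes only the block of the vertices of [G], as the edge vertices have no
   neighbours in [H]. *)
have -> : col_mx (const_mx (-1)) 0 *m invmx (x%:M - B)
          *m row_mx (const_mx (-1)) 0 = block_mx (g *: (u *m u^T)) 0 0 0
          :> 'M_(n + m).
  rewrite mul_col_mx mul0mx mul_col_row !mul0mx mulmx0; congr block_mx.
  rewrite (eJ n h) (eJ h n) mulNmx mulmxN mulNmx opprK -/u -/w.
  rewrite -!mulmxA (mulmxA w^T) (mulmxA (w^T *m _)).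
  by rewrite [w^T *m _ *m w]mx11_scalar mul_scalar_mx -scalemxAr.
rewrite opp_block_mx add_block_mx !oppr0 !addr0.
have ux : x%:M \in @unitmx K m by rewrite unitmxE det_scalar unitfE expf_neq0.
(* This is the eigenvalue of [x - (A + r) / x] on the all-ones vector; the rank one formula divides
   by it. *)
have c0 : x - r *+ 2 / x != 0.
  apply: contra x2r; rewrite subr_eq0 => /eqP e.
  by rewrite expr2 {1}e divfK.
rewrite det_schur // det_scalar invmx_scalar mulNmx mul_mx_scalar.
rewrite mulmxN mulNmx opprK -scalemxAl RR addrAC.
rewrite (det_sub_eigen_rank1 (c := x - r *+ 2 / x)) //; last first.
  rewrite mulmxBl mul_scalar_mx -scalemxAl mulmxDl Au mul_scalar_mx.
  by rewrite -scalerDl scalerA scalerBl -mulr2n mulrC.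
(* Extracting [x^-1] from a determinant of size [n] yields the division by [x ^+ n]. *)
have -> : x%:M - x^-1 *: (A + r%:M) = x^-1 *: ((x ^+ 2 - r)%:M - A).
  rewrite -[x%:M]scalemx1 -[(_ - r)%:M]scalemx1 scalerBr scalerDr scalerA.
  rewrite mulrBr expr2 mulKf // -[r%:M]scalemx1 scalerA scalerBl.
  by rewrite opprD [- _ - _]addrC addrA.
have -> : (u^T *m u) 0 0 = n%:R.
  rewrite mxE (eq_bigr (fun=> 1)) => [|i _]; last by rewrite !mxE mulr1.
  by rewrite sumr_const card_ord.
by rewrite detZ exprVn [g / _ * _]mulrAC [LHS]mulrC !mulrA [LHS]mulrAC.
Qed.

Section SvjoinCharPoly.
Variables G H : graph.
Local Notation K := {fraction {poly algC}}.

Let iota : {rmorphism algC -> K} := @tofrac {poly algC} \o polyC.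
Let X : K := @tofrac {poly algC} (polyX _).

Lemma tofrac_char_poly n (M : 'M[algC]_n) :
  tofrac (char_poly M) = \det (X%:M - map_mx iota M).
Proof.
rewrite /char_poly -det_map_mx /char_poly_mx map_mxB map_scalar_mx.
by rewrite -map_mx_comp.
Qed.

(** The determinant is the image of a monic polynomial under the injection [tofrac], hence
    nonzero. *)
Lemma char_mx_unit n (M : 'M[algC]_n) : X%:M - map_mx iota M \in unitmx.
Proof.
rewrite unitmxE -tofrac_char_poly unitfE tofrac_eq0.
by rewrite monic_neq0 ?char_poly_monic.
Qed.

(** Listing the vertices by kind, rather than by [enum_val] on the join, puts the characteristic
    matrix in block form. *)
Definition svjoin_vertex
    (i : 'I_(#|G| + #|edge G| + #|H|)) : svjoin G H :=
  match split i with
  | inl j => inl (match split j with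
                  | inl a => inl (enum_val a)
                  | inr b => inr (enum_val b)
                  end)
  | inr c => inr (enum_val c)
  end.

Lemma svjoin_vertex_bij : bijective svjoin_vertex.
Proof.
exists (fun v : svjoin G H => match v with
  | inl (inl x) => lshift _ (lshift _ (enum_rank x))
  | inl (inr e) => lshift _ (rshift _ (enum_rank e))
  | inr y => rshift _ (enum_rank y)
  end).
  move=> i; rewrite /svjoin_vertex; case: (split_ordP i) => [j|c] ->.
    by case: (split_ordP j) => [a|b] ->; rewrite enum_valK.
  by rewrite enum_valK.
rewrite /svjoin_vertex.
by case=> [[x|e]|y]; rewrite !(unsplitK (inl _), unsplitK (inr _)) enum_rankK.
Qed.

Lemma tofrac_char_poly_svjoin r :
  (forall x : G, #|[set y | adj x y]| = r) ->
  tofrac (char_poly (adjmx (svjoin G H)))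
  = X ^+ #|edge G| / X ^+ #|G|
    * (map_poly iota (char_poly (adjmx G))).[X ^+ 2 - r%:R]
    * tofrac (char_poly (adjmx H))
    * (1 - coronal (adjmx H) * #|G|%:R / (X - r%:R *+ 2 / X)).
Proof.
move=> reg.
pose entry (F : graph) (u v : F) : K := X *+ (u == v) - (adj u v)%:R.
have adjE (F : graph) : X%:M - map_mx iota (adjmx F) =
    \matrix_(i, j) entry F (enum_val i) (enum_val j).
  by apply/matrixP => i j; rewrite !mxE /entry rmorph_nat (inj_eq enum_val_inj).
rewrite !tofrac_char_poly map_char_poly horner_char_poly.
rewrite adjE (det_reindex (entry _) (@enum_val_bij _) svjoin_vertex_bij).
have X0 : X != 0 by rewrite tofrac_eq0 polyX_eq0.
(* The polynomial sizes differ: 3 on the left, at most 1 for a constant. *)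
have X2 : X ^+ 2 != r%:R *+ 2.
  rewrite -mulrnA -(rmorph_nat iota) -tofracXn tofrac_eq.
  apply/eqP => /(congr1 (size \o val)).
  by rewrite /= size_polyXn size_polyC; case: eqP.
have RR : incmx G K *m (incmx G K)^T = map_mx iota (adjmx G) + r%:R%:M.
  rewrite (incmx_mul_tr _ reg); congr (_ + _).
  by apply/matrixP => i j; rewrite !mxE rmorph_nat.
have Au : map_mx iota (adjmx G) *m const_mx 1 = r%:R *: const_mx 1 :> 'cV_#|G|.
  have := congr1 (map_mx iota) (adjmx_regular reg).
  by rewrite map_mxM map_mxZ !map_const_mx rmorph1 rmorph_nat.
(* Unfolding [coronal] identifies the target with the block formula; it remains to compare the two
   matrices entrywise. *)
rewrite -[RHS](det_svjoin_block RR Au X0 X2 (char_mx_unit _)).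
congr (\det _); apply/matrixP => i j; rewrite [LHS]mxE.
have fL k : svjoin_vertex (lshift _ (lshift _ k)) = inl (inl (enum_val k)).
  by rewrite /svjoin_vertex !(unsplitK (inl _)).
have fM k : svjoin_vertex (lshift _ (rshift _ k)) = inl (inr (enum_val k)).
  by rewrite /svjoin_vertex (unsplitK (inl _)) (unsplitK (inr _)).
have fR k : svjoin_vertex (rshift _ k) = inr (enum_val k).
  by rewrite /svjoin_vertex (unsplitK (inr _)).
have eqL (a b : G) : (inl (inl a) == inl (inl b) :> svjoin G H) = (a == b) by [].
have eqM (a b : edge G) : (inl (inr a) == inl (inr b) :> svjoin G H) = (a == b).
  by [].
have eqR (a b : H) : (inr a == inr b :> svjoin G H) = (a == b) by [].
case: (split_ordP i) => [{}i|{}i] ->; case: (split_ordP j) => [{}j|{}j] ->.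
- rewrite block_mxEul.
  case: (split_ordP i) => {}i ->; case: (split_ordP j) => {}j ->;
    rewrite ?fL ?fM ?(block_mxEul, block_mxEur, block_mxEdl, block_mxEdr) /entry.
  + by rewrite eqL (inj_eq enum_val_inj) subr0 mxE.
  + by rewrite sub0r !mxE.
  + by rewrite sub0r !mxE.
  + by rewrite eqM (inj_eq enum_val_inj) subr0 mxE.
- rewrite block_mxEur fR.
  by case: (split_ordP i) => {}i ->; rewrite ?fL ?fM ?col_mxEu ?col_mxEd mxE
    /entry ?subr0 ?sub0r.
- rewrite block_mxEdl fR.
  by case: (split_ordP j) => {}j ->; rewrite ?fL ?fM ?row_mxEl ?row_mxEr mxE
    /entry ?subr0 ?sub0r.
- by rewrite block_mxEdr !fR /entry eqR (inj_eq enum_val_inj) !mxE rmorph_nat.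
Qed.

End SvjoinCharPoly.

Theorem corollary2p7 :
  (forall G1 G2 H : graph,
     regular G1 -> regular G2 -> A_cospectral G1 G2 ->
     A_cospectral (svjoin G1 H) (svjoin G2 H))
  /\
  (forall G H1 H2 : graph,
     regular G -> A_cospectral H1 H2 ->
     coronal (adjmx H1) = coronal (adjmx H2) ->
     A_cospectral (svjoin G H1) (svjoin G H2)).
Proof.
have of_tofrac (G1 G2 : graph) :
    tofrac (char_poly (adjmx G1)) = tofrac (char_poly (adjmx G2)) ->
    A_cospectral G1 G2.
  by move=> /eqP; rewrite tofrac_eq /A_cospectral /eigen_mult => /eqP ->.
split=> [G1 G2 H [r1 reg1] [r2 reg2] | G H1 H2 [r reg]] /char_poly_cospectral eqp.
  (* The number of vertices is the degree of the characteristic polynomial, one less than its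
     size. *)
  have card12 : #|G1| = #|G2|.
    by have := congr1 (size \o val) eqp; rewrite /= !size_char_poly => -[].
  have r12 : r1 = r2.
    apply/eqP; rewrite eqn_leq (cospectral_degree_le reg1 reg2) //.
    by rewrite (cospectral_degree_le reg2 reg1).
  have edges12 : #|edge G1| = #|edge G2|.
    by apply: double_inj; rewrite -(handshake reg1) -(handshake reg2) card12 r12.
  apply: of_tofrac.
  rewrite (tofrac_char_poly_svjoin H reg1) (tofrac_char_poly_svjoin H reg2).
  by rewrite eqp card12 r12 edges12.
move=> eqc; apply: of_tofrac.
by rewrite !(tofrac_char_poly_svjoin _ reg) eqp eqc.
Qed.
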